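(* Let $N$ be a positive integer, let $f:\mathbb{Z}_N\to\mathbb{Z}_N$ be a function, and let $S_D=\{S_0,\dots,S_{n_K-1}\}$ be a collection of pairwise disjoint subsets of $\mathbb{Z}_N$ with $\bigcup_j S_j=\mathbb{Z}_N$ and $|f(S_j)|=|S_j|$ for every $j$. Let $\mathcal{E}_{S_D,f}$ be the quantum channel generated from $f$ and $S_D$, and let $\mathcal{L}_{\mathcal{E}}$ be its $N^2\times N^2$ matrix representation. Then every eigenvalue of $\mathcal{L}_{\mathcal{E}}$ is either $0$ or has modulus $1$.
   Context: Here $\mathbb{Z}_N=\{0,1,\dots,N-1\}$ is regarded just as a set, and $f(S_j)=\{f(k):k\in S_j\}$. Let $\mathcal{H}$ be an $N$-dimensional complex Hilbert space with orthonormal basis $\{|x\rangle : x\in\mathbb{Z}_N\}$, and let $\mathcal{B}(\mathcal{H})$ be the space of linear operators on $\mathcal{H}$. The channel $\mathcal{E}_{S_D,f}:\mathcal{B}(\mathcal{H})\to\mathcal{B}(\mathcal{H})$ generated from $f$ and $S_D$ is the linear map $$\mathcal{E}_{S_D,f}(X)=\sum_{j=0}^{n_K-1}K_jXK_j^\dagger,\qquad K_j=\sum_{i\in S_j}|f(i)\rangle\langle i| .$$ The matrix representation (Liouville representation) $\mathcal{L}_{\mathcal{E}}$ of a linear map $\mathcal{E}$ on $\mathcal{B}(\mathcal{H})$ is the $N^2\times N^2$ complex matrix with entries $\mathcal{L}_{\mathcal{E},\alpha\beta}=\operatorname{tr}(F_\alpha^\dagger\,\mathcal{E}(F_\beta))$,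 where $F_\alpha,F_\beta$ range over the matrix units $\{|i\rangle\langle j| : i,j\in\mathbb{Z}_N\}$; that is, it is the matrix of $\mathcal{E}$ in the basis of matrix units. *)

(* Defs.v *)
From HB Require Import structures.
From mathcomp Require Import all_boot all_order all_algebra.
From mathcomp Require Import complex reals.

Set Implicit Arguments.
Unset Strict Implicit.
Unset Printing Implicit Defensive.

Import GRing.Theory Num.Theory.
Local Open Scope ring_scope.
Local Open Scope sesquilinear_scope.

(* The N-dimensional Hilbert space is identified with C^N through its
   orthonormal basis |0>, ..., |N-1>: an operator X is the matrix with entries
   X i j = <i|X|j>, so that |i><j| is [delta_mx i j] and the adjoint is [^t*]. *)

Section Channel.
Variables (C : numClosedFieldType) (N nK : nat).
Variables (f : 'I_N -> 'I_N) (S : 'I_nK -> {set 'I_N}).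

Definition kraus (j : 'I_nK) : 'M[C]_N := \sum_(i in S j) delta_mx (f i) i.

Definition channel (X : 'M[C]_N) : 'M[C]_N :=
  \sum_(j < nK) (kraus j *m X *m (kraus j)^t*).

Fact channel_is_linear : linear channel.
Proof.
move=> a X Y; rewrite /channel scaler_sumr -big_split /=.
by apply: eq_bigr => j _; rewrite mulmxDr mulmxDl -scalemxAr -scalemxAl.
Qed.

HB.instance Definition _ :=
  GRing.isLinear.Build C 'M[C]_N 'M[C]_N _ channel channel_is_linear.

End Channel.

Arguments kraus C {N nK} f S j.
Arguments channel C {N nK} f S X.

Section Liouville.
Variables (C : numClosedFieldType) (N : nat).

(* The pairs (i, j) are enumerated by [mxvec_index i j : 'I_(N * N)], whose
   matrix unit is |i><j| (see [matunitE]). *)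
Definition matunit (a : 'I_(N * N)) : 'M[C]_N := vec_mx (delta_mx 0 a).

Fact matunitE (i j : 'I_N) : matunit (mxvec_index i j) = delta_mx i j.
Proof. exact: vec_mx_delta. Qed.

Definition liouville (E : {linear 'M[C]_N -> 'M[C]_N}) : 'M[C]_(N * N) :=
  \matrix_(a, b) \tr ((matunit a)^t* *m E (matunit b)).

End Liouville.

(* Main.v *)
(** On matrix units the channel acts by [|k><l| |-> |f k><f l|] if [k] and [l]
    lie in a common block, and by [|k><l| |-> 0] otherwise.  A left eigenvector
    [v] for [lambda != 0] thus satisfies [v (f k, f l) = lambda * v (k, l)]
    wherever [v (k, l) != 0].  Following the orbit of such a pair, which must
    return to itself since there are finitely many pairs, gives two distinct
    powers of [lambda] that agree, so [lambda] is a root of unity. *)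
Require Import Defs.
From mathcomp Require Import all_boot all_order all_algebra.
From mathcomp Require Import complex reals.
Import GRing.Theory Num.Theory.
Local Open Scope ring_scope.
Local Open Scope complex_scope.
Local Open Scope sesquilinear_scope.

Lemma root_of_unity_norm1 (C : numDomainType) (z : C) (n : nat) :
  (0 < n)%N -> z ^+ n = 1 -> `|z| = 1.
Proof.
move=> n_gt0 zn1; apply/eqP; rewrite -(pexpr_eq1 n_gt0) ?normr_ge0 //.
by rewrite -normrX zn1 normr1.
Qed.

Lemma orbit_eigenvalue_norm1 (C : numFieldType) (T : finType) (g : T -> T)
    (w : T -> C) (z : C) (x : T) :
  z != 0 -> w x != 0 -> (forall y, w y != 0 -> w (g y) = z * w y) ->
  `|z| = 1.
Proof.
move=> z0 wx0 wg.
have witer n : w (iter n g x) = z ^+ n * w x.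
  elim: n => [|n IHn] /=; first by rewrite mul1r.
  by rewrite wg IHn ?mulf_neq0 ?expf_neq0 // exprS mulrA.
(* [g] need not be injective, so the orbit may re-enter itself at some [m > 0]; the factor [z ^+ m]
   is cancelled below, as [z != 0]. *)
have /trajectP[m lt_m fE] := looping_order g x.
have /(mulIf wx0) zE : z ^+ order g x * w x = z ^+ m * w x by rewrite -!witer fE.
apply: (@root_of_unity_norm1 _ _ (order g x - m)); first by rewrite subn_gt0.
apply: (mulIf (expf_neq0 m z0)).
by rewrite -exprD subnK ?mul1r // ltnW.
Qed.

Section Channel.
Variables (C : numClosedFieldType) (N nK : nat).
Variables (f : 'I_N -> 'I_N) (S : 'I_nK -> {set 'I_N}).

Lemma kraus_mul_delta (j : 'I_nK) m (k : 'I_N) (l : 'I_m) :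
  kraus C f S j *m delta_mx k l = (k \in S j)%:R *: delta_mx (f k) l.
Proof.
rewrite /kraus mulmx_suml; case: (boolP (k \in S j)) => kS.
  rewrite (bigD1 k) //= mul_delta_mx scale1r big1 ?addr0 // => i /andP[_ ik].
  by rewrite mul_delta_mx_0.
rewrite scale0r big1 // => i iS; rewrite mul_delta_mx_0 //.
by apply: contraNneq kS => <-.
Qed.

Lemma kraus_conj_delta (j : 'I_nK) (k l : 'I_N) :
  kraus C f S j *m delta_mx k l *m (kraus C f S j)^t* =
  ((k \in S j) && (l \in S j))%:R *: delta_mx (f k) (f l).
Proof.
rewrite kraus_mul_delta -scalemxAl.
(* With the matrix unit written as an adjoint, the right factor is absorbed by a second use of
   [kraus_mul_delta]. *)
have -> : delta_mx (f k) l = (delta_mx l (f k) : 'M[C]_N)^t*.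
  by rewrite trmx_delta map_delta_mx.
rewrite -map_mxM -trmx_mul kraus_mul_delta linearZ /= map_mxZ rmorph_nat.
by rewrite trmx_delta map_delta_mx scalerA -natrM mulnb.
Qed.

Lemma channel_delta (k l : 'I_N) :
  (forall i j, i != j -> [disjoint S i & S j]) ->
  channel C f S (delta_mx k l) =
  [exists j, (k \in S j) && (l \in S j)]%:R *: delta_mx (f k) (f l).
Proof.
move=> S_disj; rewrite /channel; under eq_bigr do rewrite kraus_conj_delta.
case: existsP => [[j kl_j] | no_j].
  (* By disjointness [S j] is the only block containing [k], so every other term vanishes. *)
  rewrite (bigD1 j) //= kl_j big1 ?addr0 // => i ij.
  have [/andP[ki _] | _] := boolP ((k \in S i) && _); last by rewrite scale0r.
  by case/andP: kl_j => kj _; rewrite (disjointFr (S_disj _ _ ij) ki) in kj.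
rewrite scale0r big1 // => j _.
by have [kl|_] := boolP (_ && _); [case: no_j; exists j | rewrite scale0r].
Qed.

End Channel.

(** Matrix units are orthonormal for the trace inner product, so pairing with them reads off
    coordinates. *)
Lemma mxtrace_matunit (C : numClosedFieldType) (N : nat) (a : 'I_(N * N))
    (X : 'M[C]_N) :
  \tr ((matunit C a)^t* *m X) = mxvec X 0 a.
Proof.
case/mxvec_indexP: a => i j; rewrite matunitE mxvecE trmx_delta map_delta_mx.
rewrite /mxtrace (bigD1 j) //= big1 ?addr0 => [|k kj].
  rewrite mxE (bigD1 i) //= mxE !eqxx mul1r big1 ?addr0 // => k ki.
  by rewrite mxE (negPf ki) andbF mul0r.
by rewrite mxE big1 // => l _; rewrite mxE (negPf kj) mul0r.
Qed.

(** Column [(k, l)] of the Liouville matrix holds the coordinates of the image of [|k><l|], so its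
    only possible nonzero entry is in row [(f k, f l)]. The vector stands on the left because
    [eigenvalue] is defined by row vectors. *)
Lemma mul_liouville_channel (C : numClosedFieldType) (N nK : nat)
    (f : 'I_N -> 'I_N) (S : 'I_nK -> {set 'I_N}) (v : 'rV[C]_(N * N))
    (k l : 'I_N) :
  (forall i j, i != j -> [disjoint S i & S j]) ->
  (v *m liouville (channel C f S)) 0 (mxvec_index k l) =
  [exists j, (k \in S j) && (l \in S j)]%:R * v 0 (mxvec_index (f k) (f l)).
Proof.
move=> S_disj; rewrite mxE.
under eq_bigr => a _.
  rewrite mxE mxtrace_matunit matunitE /= channel_delta // linearZ /= mxvec_delta.
  rewrite !mxE eqxx /= mulrCA.
over.
rewrite -mulr_sumr (bigD1 (mxvec_index (f k) (f l))) //= eqxx mulr1.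
by rewrite big1 ?addr0 // => a /negPf->; rewrite mulr0.
Qed.

Theorem theorem2 (R : realType) (N : nat) (hN : (0 < N)%N)
  (f : 'I_N -> 'I_N) (nK : nat) (S : 'I_nK -> {set 'I_N})
  (S_disjoint : forall j k : 'I_nK, j != k -> [disjoint S j & S k])
  (S_cover : \bigcup_(j < nK) S j = [set: 'I_N])
  (S_card : forall j : 'I_nK, #|f @: S j| = #|S j|)
  (lambda : R[i]) :
  eigenvalue (liouville (channel R[i] f S)) lambda ->
  lambda = 0 \/ `|lambda| = 1.
Proof.
case/eigenvalueP => v vL v_neq0.
have [->|lambda0] := eqVneq lambda 0; [by left | right].
have [a va] : exists a, v 0 a != 0 by apply/rV0Pn.
case/mxvec_indexP: a va => k l vkl.
apply: (@orbit_eigenvalue_norm1 _ _ (fun p => (f p.1, f p.2))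
  (fun p => v 0 (mxvec_index p.1 p.2)) _ (k, l) lambda0 vkl) => -[i j] /= vij.
have /= vLE := mul_liouville_channel R[i] _ _ f S v i j S_disjoint.
(* [vL] and [vLE] multiply with only convertible ring structures on [R[i]], so
   rewriting one with the other fails. *)
have := etrans (esym vLE)
  (congr1 (fun u : 'rV_(N * N) => u 0 (mxvec_index i j)) vL).
(* If [i] and [j] shared no block, [lambda * v (i, j)] would be 0 with both factors nonzero. *)
rewrite [RHS]mxE; case: [exists _, _]; rewrite ?mul1r // mul0r => /esym/eqP.
by rewrite mulf_eq0 (negPf lambda0) (negPf vij).
Qed.
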